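(* Let $s\in\mathbb N$, let $\mathcal X\subseteq\mathbb R^d$ be a set which is contained in the closure of its interior, and let $K:\mathcal X\times\mathcal X\to\mathbb R^{Q\times Q}$ be a matrix-valued kernel such that $K\in\mathcal C^{s,s}(\mathcal X\times\mathcal X,\mathbb R^{Q\times Q})$, with associated vector-valued reproducing kernel Hilbert space $\mathcal F_K$. Let $D\in O_{Q,s}$ be a differential operator, $D(\mathbf f)(\mathbf x)=\sum_{q=1}^Q\beta_q D_q f_q(\mathbf x)$ with $\beta_q\in\mathbb R$ and $D_q\in O_{1,s}$. Define $$DK(\mathbf x',\mathbf x):=\sum_{q=1}^{Q}\beta_q\,[D_{q,\mathbf x}K(\mathbf x',\mathbf x)]\,\mathbf e_q\in\mathbb R^Q,$$ where $D_{q,\mathbf x}K(\mathbf x',\mathbf x):=D_q[\mathbf x''\mapsto K(\mathbf x',\mathbf x'')](\mathbf x)\in\mathbb R^{Q\times Q}$ and $\mathbf e_q\in\mathbb R^Q$ is the $q$-th canonical basis vector. Then for all $\mathbf f\in\mathcal F_K$ and $\mathbf x\in\mathcal X$: $$\mathbf f\in\mathcal C^s(\mathcal X,\mathbb R^Q),\qquad DK(\cdot,\mathbf x)\in\mathcal F_K,\qquad D(\mathbf f)(\mathbf x)=\langle \mathbf f,DK(\cdot,\mathbf x)\rangle_K .$$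
   Context: Here $\mathbb N=\{0,1,\dots\}$. Matrix-valued kernel: $K:\mathcal X\times\mathcal X\to\mathbb R^{Q\times Q}$ with $K(\mathbf x,\mathbf x')=K(\mathbf x',\mathbf x)^\top$ for all $\mathbf x,\mathbf x'$ and $\sum_{i,j=1}^N\mathbf v_i^\top K(\mathbf x_i,\mathbf x_j)\mathbf v_j\ge 0$ for all $N\ge1$, $\mathbf x_1,\dots,\mathbf x_N\in\mathcal X$, $\mathbf v_1,\dots,\mathbf v_N\in\mathbb R^Q$. Its vector-valued RKHS $\mathcal F_K$ (inner product $\langle\cdot,\cdot\rangle_K$, norm $\|\cdot\|_K$) is the unique Hilbert space of functions $\mathcal X\to\mathbb R^Q$ such that $K(\cdot,\mathbf x)\mathbf c\in\mathcal F_K$ and $\langle\mathbf f,K(\cdot,\mathbf x)\mathbf c\rangle_K=\langle\mathbf f(\mathbf x),\mathbf c\rangle$ for all $\mathbf f\in\mathcal F_K$, $\mathbf x\in\mathcal X$, $\mathbf c\in\mathbb R^Q$. For a multi-index $\mathbf r\in\mathbb N^d$, $|\mathbf r|=\sum_j r_j$; $\partial^{\mathbf r}$ is the corresponding partial derivative; $\partial^{\mathbf r,\mathbf r}f(\mathbf x,\mathbf y)$ is the derivative of order $\mathbf r$ in $\mathbf x$ and of order $\mathbf r$ in $\mathbf y$. $\mathcal C^s(\mathcal X,\mathbb R^Q)$: functions with continuous derivatives on $\mathcal X$ up to order $s$. $\mathcal C^{s,s}(\mathcal X\times\mathcal X,\mathbb R^{Q\times Q})$: functions for which $\partial^{\mathbf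 r,\mathbf r}f$ exists and is continuous for all $|\mathbf r|\le s$. Derivatives at points of $\mathcal X$ that are not interior are understood as continuous extensions of the derivatives from the interior of $\mathcal X$. $O_{1,s}$: operators on real-valued functions of the form $D(f)(\mathbf x)=\sum_{j\in J}c_j\partial^{\mathbf r_j}f(\mathbf x)$ with $J$ finite, $|\mathbf r_j|\le s$, $c_j\in\mathbb R$. $O_{Q,s}$: operators on $\mathbb R^Q$-valued functions of the form $D(\mathbf f)(\mathbf x)=\sum_{q=1}^Q\beta_qD_q(f_q)(\mathbf x)$ with $\beta_q\in\mathbb R$, $D_q\in O_{1,s}$. Operators in $O_{1,s}$ act entrywise on matrix-valued functions. *)

(* Defs.v *)
From HB Require Import structures.
From mathcomp Require Import all_boot all_order all_algebra.
From mathcomp Require Import all_classical all_reals all_analysis.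

Set Implicit Arguments.
Unset Strict Implicit.
Unset Printing Implicit Defensive.

Import Order.TTheory GRing.Theory Num.Theory.
Import numFieldNormedType.Exports.

Local Open Scope classical_set_scope.
Local Open Scope ring_scope.

Section IteratedDerivatives.
Context {R : realType} {V : normedModType R}.
Implicit Types (A : set V) (vs : seq V) (f : V -> R).

(* 'D_v1 ('D_v2 (... ('D_vk f))) for vs = [:: v1; ...; vk] *)
Definition iter_derive vs f : V -> R :=
  foldr (fun v g => fun x => 'D_v g x) f vs.

Fixpoint iter_derivable A vs f : Prop :=
  if vs is v :: vs' then
    iter_derivable A vs' f /\
    (forall x, A° x -> derivable (iter_derive vs' f) x v)
  else True.

(* The derivative along vs at a point of A: at a non-interior point it is the
   limit of the derivative at interior points.  The derivative of order 0 is f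
   itself on all of A.  The value is meaningful only under cont_derivative. *)
Definition derive_on A vs f (x : V) : R :=
  if vs is [::] then f x
  else if x \in (A° : set V) then iter_derive vs f x
  else lim (iter_derive vs f y @[y --> within A° (nbhs x)]).

(* The derivative along vs exists in the interior of A and extends continuously
   to A.  When A is contained in the closure of its interior, continuity of
   derive_on within A forces the limits in its definition to exist. *)
Definition cont_derivative A vs f : Prop :=
  iter_derivable A vs f /\ {within A, continuous (derive_on A vs f)}.

End IteratedDerivatives.

Section MultiIndices.
Context {R : realType} {d : nat}.

Definition basis_vec (i : 'I_d) : 'rV[R]_d := delta_mx 0 i.

Definition mi_order (r : 'I_d -> nat) : nat := (\sum_(i < d) r i)%N.

(* The multi-index (r_0, ..., r_(d-1)) as the sequence of coordinates
   0 (r_0 times), 1 (r_1 times), ... *)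
Definition mi_seq (r : 'I_d -> nat) : seq 'I_d :=
  flatten [seq nseq (r i) i | i <- enum 'I_d].

Definition mi_dirs (r : 'I_d -> nat) : seq 'rV[R]_d :=
  [seq basis_vec i | i <- mi_seq r].

Definition mi_dirs2 (r : 'I_d -> nat) : seq ('rV[R]_d * 'rV[R]_d) :=
  [seq (v, 0) | v <- mi_dirs r] ++ [seq (0, v) | v <- mi_dirs r].

End MultiIndices.

(* Functions on a set X are functions on the subtype X.  To differentiate them,
   they are extended by 0 outside X, which does not affect derivatives at
   interior points. *)
Section FunctionsOnX.
Context {R : realType} {d : nat} {X : set 'rV[R]_d}.

Definition zext (f : X -> R) : 'rV[R]_d -> R := 'valL_ 0 f.

Definition zext2 (k : X -> X -> R) : 'rV[R]_d * 'rV[R]_d -> R :=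
  fun z => zext (fun x => zext (k x) z.2) z.1.

Definition partial (r : 'I_d -> nat) (f : X -> R) (x : X) : R :=
  derive_on X (mi_dirs r) (zext f) (val x).

(* All iterated partial derivatives of order at most s, taken in any order. *)
Definition Cs (s : nat) {Q : nat} (f : X -> 'cV[R]_Q) : Prop :=
  forall (q : 'I_Q) (l : seq 'I_d), (size l <= s)%N ->
    cont_derivative X [seq basis_vec i | i <- l] (zext (fun x => f x q 0)).

(* Only the derivatives of order r in x and of order r in y are required to be
   continuous, each being taken in one fixed order of differentiation. *)
Definition Css (s : nat) {m n : nat} (K : X -> X -> 'M[R]_(m, n)) : Prop :=
  forall (i : 'I_m) (j : 'I_n) (r : 'I_d -> nat), (mi_order r <= s)%N ->
    cont_derivative (X `*` X) (mi_dirs2 r) (zext2 (fun x y => K x y i j)).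

Definition O_1 (s : nat) : set ((X -> R) -> X -> R) :=
  [set D | exists (n : nat) (c : 'I_n -> R) (r : 'I_n -> 'I_d -> nat),
     (forall j, (mi_order (r j) <= s)%N) /\
     (forall f x, D f x = \sum_(j < n) c j * partial (r j) f x)].

Section VectorOperators.
Context {Q : nat}.
Variables (beta : 'I_Q -> R) (Dq : 'I_Q -> (X -> R) -> X -> R).

(* The general element of O_(Q,s), when each Dq q is in O_(1,s). *)
Definition vec_op (f : X -> 'cV[R]_Q) (x : X) : R :=
  \sum_(q < Q) beta q * Dq q (fun y => f y q 0) x.

Definition op_kernel (K : X -> X -> 'M[R]_Q) (x' x : X) : 'cV[R]_Q :=
  \sum_(q < Q) beta q *:
    ((\matrix_(i, j) Dq q (fun x'' => K x' x'' i j) x) *m delta_mx q 0).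

End VectorOperators.
End FunctionsOnX.

Definition matrix_kernel {R : realType} {T : Type} {Q : nat}
    (K : T -> T -> 'M[R]_Q) : Prop :=
  (forall x x', K x x' = (K x' x)^T) /\
  (forall (N : nat) (x : 'I_N -> T) (v : 'I_N -> 'cV[R]_Q), (1 <= N)%N ->
     0 <= \sum_(i < N) \sum_(j < N) ((v i)^T *m K (x i) (x j) *m v j) 0 0).

(* A Hilbert space of functions T -> R^Q is a Banach space whose norm comes from
   an inner product, with an injective linear map sending each element to the
   function it denotes. *)
Record rkhs (R : realType) (T : Type) (Q : nat) (K : T -> T -> 'M[R]_Q) := Rkhs {
  rkhs_space :> completeNormedModType R;
  rkhs_dot : {dot rkhs_space for idfun};
  rkhs_norm : forall f : rkhs_space, `|f| ^+ 2 = rkhs_dot f f;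
  rkhs_fun : {linear rkhs_space -> (T -> 'cV[R]_Q)};
  rkhs_fun_inj : injective rkhs_fun;
  rkhs_repr : forall (x : T) (c : 'cV[R]_Q), exists k : rkhs_space,
    rkhs_fun k = (fun x' => K x' x *m c) /\
    (forall f, rkhs_dot f k = ((rkhs_fun f x)^T *m c) 0 0) }.

(* Main.v *)
(* The representers phi(x) of the evaluations f |-> f_q(x) form a feature map,
   and the entry K_qq(x, y) is the inner product of phi(x) and phi(y).  Taking an
   iterated difference quotient of phi at x and another one at y, the mean value
   theorem shows that their inner product is the derivative of order (r, r) of
   K_qq at some intermediate point.  As this derivative is continuous, the
   difference quotients of phi of order r are Cauchy when all their steps tend to
   0 independently, and converge to some psi(x).  Difference operators commute,
   and in a joint limit the steps can be sent to 0 one direction at a time, so psi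
   is the derivative of phi taken in any order, whence d^r f_q = <f, psi>.  The
   Gram matrix <psi(x), psi(y)> being continuous up to the boundary, so is psi. *)
Require Import Defs.
From HB Require Import structures.
From mathcomp Require Import all_boot all_order all_algebra.
From mathcomp Require Import all_classical all_reals all_analysis.
From mathcomp Require Import ring lra.

Set Implicit Arguments.
Unset Strict Implicit.
Unset Printing Implicit Defensive.

Import Order.TTheory GRing.Theory Num.Theory.
Import numFieldNormedType.Exports.

Local Open Scope classical_set_scope.
Local Open Scope ring_scope.

(** * Inner products and convergence read off from Gram values *)

Section DotProduct.
Context {R : realType} {H : normedModType R} (dot : {dot H for idfun}).
Hypothesis dotE : forall u : H, `|u| ^+ 2 = dot u u.
Implicit Types u v : H.

Lemma dotC u v : dot u v = dot v u.
Proof. by rewrite hermC expr0 mul1r. Qed.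

Lemma normB_sqr u v : `|u - v| ^+ 2 = dot u u - dot u v *+ 2 + dot v v.
Proof.
rewrite dotE linearBl/= !linearBr/= (dotC v u); ring.
Qed.

(** Polarization expresses the inner product through norms, so continuity of the norm suffices. *)
Lemma cvg_dot {I : Type} (F : set_system I) {FF : Filter F} (a b : I -> H) u v :
  a @ F --> u -> b @ F --> v -> dot (a i) (b i) @[i --> F] --> dot u v.
Proof.
move=> au bv.
have polar x y : dot x y = 2^-1 * (`|x| ^+ 2 + `|y| ^+ 2 - `|x - y| ^+ 2).
  by rewrite normB_sqr !dotE; field.
rewrite polar (_ : (fun i => _) = fun i => 2^-1 *
  (`|a i| ^+ 2 + `|b i| ^+ 2 - `|a i - b i| ^+ 2)); last first.
  by apply/funext => i; exact: polar.
have cvg_sqr (c : I -> H) w : c @ F --> w -> `|c i| ^+ 2 @[i --> F] --> `|w| ^+ 2.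
  move=> cw; rewrite expr2; under eq_fun do rewrite expr2.
  by apply: cvgM; exact: cvg_norm.
apply: cvgMl_tmp; apply: cvgB; last by apply: cvg_sqr; exact: cvgB.
by apply: cvgD; exact: cvg_sqr.
Qed.

(** The squared distance is a combination of the three Gram values with coefficients 1, -2, 1. These
    sum to 0, so [c] cancels, and the errors add up to less than [4 e]. *)
Lemma gram_dist_lt (c e : R) u v :
  `|dot u u - c| < e -> `|dot u v - c| < e -> `|dot v v - c| < e ->
  `|u - v| ^+ 2 < e *+ 4.
Proof.
rewrite normB_sqr !ltr_norml => /andP[? ?] /andP[? ?] /andP[? ?]; lra.
Qed.

Lemma gram_cvg_to {I : Type} (F : set_system I) {FF : Filter F} (a : I -> H) u :
  dot (a i) (a i) @[i --> F] --> dot u u ->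
  dot (a i) u @[i --> F] --> dot u u -> a @ F --> u.
Proof.
move=> aa au; apply/cvgrPdist_lt => e e0.
(* This tolerance absorbs the factor 4 of [gram_dist_lt]. *)
have e4 : 0 < e ^+ 2 / 4 by rewrite divr_gt0// exprn_gt0.
near=> i; rewrite -(@ltr_pXn2r _ 2)// ?nnegrE ?(ltW e0)//.
rewrite distrC (_ : e ^+ 2 = (e ^+ 2 / 4) *+ 4); last by field.
apply: (@gram_dist_lt (dot u u)); last by rewrite subrr normr0.
- by rewrite distrC; near: i; move/cvgrPdist_lt : aa; exact.
- by rewrite distrC; near: i; move/cvgrPdist_lt : au; exact.
Unshelve. all: by end_near. Qed.

End DotProduct.

(** Pairs of indices from one set of the filter, equal indices included, have Gram values near [c].
    The images are therefore Cauchy, and completeness supplies the limit. *)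
Lemma gram_cvg {R : realType} {H : completeNormedModType R}
    (dot : {dot H for idfun}) (dotE : forall u : H, `|u| ^+ 2 = dot u u)
    {I : Type} (F : set_system I) {FF : ProperFilter F} (a : I -> H) (c : R) :
  dot (a p.1) (a p.2) @[p --> (F, F)] --> c -> cvg (a @ F).
Proof.
move=> aac; apply/cauchy_cvgP/cauchy_ballP => e e0.
have e4 : 0 < e ^+ 2 / 4 by rewrite divr_gt0// exprn_gt0.
have /cvgrPdist_lt/(_ _ e4) := aac; rewrite near_simpl => -[[P Q] [/= FP FQ] PQ].
have FPQ : F (P `&` Q) by exact: filterI.
have PQc i j : (P `&` Q) i -> (P `&` Q) j -> `|dot (a i) (a j) - c| < e ^+ 2 / 4.
  by move=> [Pi _] [_ Qj]; rewrite distrC; apply: (PQ (i, j)).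
exists (a @` (P `&` Q), a @` (P `&` Q)).
  by split; rewrite /= /nbhs/=; apply: filterS FPQ => i PQi; exists i.
move=> [_ _] [/= [i PQi <-] [j PQj <-]]; rewrite -ball_normE /=.
rewrite -(@ltr_pXn2r _ 2)// ?nnegrE ?(ltW e0)//.
rewrite (_ : e ^+ 2 = (e ^+ 2 / 4) *+ 4); last by field.
by apply: (gram_dist_lt dotE); exact: PQc.
Qed.

(** The filter [steps] below admits the directions in any order, while smoothness is assumed for a
    single order; this rearranges the pairs to match it. *)
Lemma perm_unzip2 (S T : eqType) (s : seq (S * T)) (t : seq T) :
  perm_eq (unzip2 s) t -> exists2 s', perm_eq s s' & unzip2 s' = t.
Proof.
case: s => [|a s]; first by move=> /perm_size/esym/size0nil ->; exists [::].
rewrite perm_sym => /(perm_iotaP a.2)[Is IsE ->].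
exists [seq nth a (a :: s) i | i <- Is].
  rewrite perm_sym -{2}(mkseq_nth a (a :: s)) /mkseq perm_map//.
  by rewrite size_map in IsE.
rewrite /unzip2 -map_comp; apply/eq_in_map => i.
rewrite (perm_mem IsE) mem_iota size_map => /andP[_ ip].
by rewrite /= -(nth_map _ a.2).
Qed.

(** * Iterated difference quotients and their mean value theorem *)

Section DifferenceQuotients.
Context {R : realType} {V : normedModType R}.
Implicit Types (p : seq (R * V)) (x w : V).

(** Each pair consists of a step and a direction; the head of the list is the outermost quotient. *)
Definition diffq {W : normedModType R} p (g : V -> W) : V -> W :=
  foldr (fun a G x => a.1^-1 *: (G (a.1 *: a.2 + x) - G x)) g p.

(** Bounds the distance from [x] to every point at which [diffq p g x] evaluates [g]. *)
Definition reach p : R := \sum_(a <- p) `|a.1 *: a.2|.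

Lemma reach_ge0 p : 0 <= reach p.
Proof. exact: sumr_ge0. Qed.

Lemma reach_cons a p : reach (a :: p) = `|a.1 *: a.2| + reach p.
Proof. by rewrite /reach big_cons. Qed.

Lemma reach_perm p p' : perm_eq p p' -> reach p = reach p'.
Proof. exact: perm_big. Qed.

Section Target.
Context {W : normedModType R}.
Implicit Types g : V -> W.

Lemma diffq_cat p p' g : diffq (p ++ p') g = diffq p (diffq p' g).
Proof. exact: foldr_cat. Qed.

(** Translations commute: taking two increments in either order gives the same alternating sum of
    four values. *)
Lemma diffq_incr p (c : R) w g :
  diffq p (fun x => c *: (g (w + x) - g x)) =
  fun x => c *: (diffq p g (w + x) - diffq p g x).
Proof.
elim: p => [//|a p IH] /=; rewrite IH; apply/funext => x.
rewrite (addrCA w) -[in LHS]scalerBr -[in RHS]scalerBr !scalerA mulrC; congr (_ *: _).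
by rewrite !opprB addrACA [RHS]addrACA [X in _ + X]addrC.
Qed.

Lemma diffqC p p' g : diffq p (diffq p' g) = diffq p' (diffq p g).
Proof.
elim: p' p g => [//|a p' IH] p g /=.
by rewrite diffq_incr IH.
Qed.

Lemma diffq_perm p p' g : perm_eq p p' -> diffq p g = diffq p' g.
Proof.
move: p p'; apply: catCA_perm_subst => p1 p2 p3.
by rewrite !diffq_cat diffqC.
Qed.

Lemma is_derive_translate w x v g (dg : W) :
  is_derive (w + x) v g dg -> is_derive x v (fun y => g (w + y)) dg.
Proof.
have E : (fun h : R => h^-1 *: (((fun y => g (w + y)) \o shift x) (h *: v) - g (w + x)))
   = (fun h : R => h^-1 *: ((g \o shift (w + x)) (h *: v) - g (w + x))).
  by apply/funext => h /=; rewrite addrCA.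
by move=> [dv dE]; split; rewrite ?/derivable ?/derive E.
Qed.

(** A difference quotient is a finite linear combination of translates of [g], so differentiation
    passes through it. *)
Lemma is_derive_diffq p g x v :
  (forall y, `|y - x| <= reach p -> derivable g y v) ->
  is_derive x v (diffq p g) (diffq p ('D_v g) x).
Proof.
elim: p x => [|a p IH] x /= dg.
  by apply/derivableP/dg; rewrite subrr normr0 reach_ge0.
apply: is_deriveZ; apply: is_deriveB.
  apply: is_derive_translate; apply: IH => y yx; apply: dg.
  rewrite reach_cons -[y](subrK (a.1 *: a.2 + x)) -addrA addrK addrC.
  by rewrite (le_trans (ler_normD _ _))// lerD2l.
apply: IH => y yx; apply: dg.
by rewrite reach_cons (le_trans yx)// lerDr.
Qed.

End Target.

(** This is the one-variable mean value theorem for [t |-> g (t *: v + x)] between 0 and [h]; the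
    sign of [h] decides which endpoint comes first. *)
Lemma diffq1_mvt (h : R) v x (g : V -> R) : h != 0 ->
  (forall y, `|y - x| <= `|h *: v| -> derivable g y v) ->
  exists2 y, `|y - x| <= `|h *: v| & h^-1 *: (g (h *: v + x) - g x) = 'D_v g y.
Proof.
move=> h0 dg; pose u (t : R) := g (t *: v + x).
have du (t : R) : `|t| <= `|h| -> is_derive t 1 u ('D_v g (t *: v + x)).
  move=> th; have : is_derive (t *: v + x) v g ('D_v g (t *: v + x)).
    by apply/derivableP/dg; rewrite addrK !normrZ ler_wpM2r.
  have E : (fun e : R => e^-1 *: ((u \o shift t) (e *: 1) - u t)) =
     (fun e : R => e^-1 *: ((g \o shift (t *: v + x)) (e *: v) - g (t *: v + x))).
    by apply/funext => e; rewrite /u /= [e *: 1]mulr1 scalerDl addrA.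
  by move=> [dv dE]; split; rewrite ?/derivable ?/derive E.
have u0 : u 0 = g x by rewrite /u scale0r add0r.
have conc (c : R) : `|c| <= `|h| -> u h - u 0 = 'D_v g (c *: v + x) * h ->
    exists2 y, `|y - x| <= `|h *: v| & h^-1 *: (g (h *: v + x) - g x) = 'D_v g y.
  move=> ch E; exists (c *: v + x); first by rewrite addrK !normrZ ler_wpM2r.
  by rewrite -u0 -/(u h) E [_ *: _]mulrC mulfK.
have cu (a b : R) : (forall t, t \in `[a, b]%R -> `|t| <= `|h|) ->
    {within `[a, b], continuous u}.
  move=> ab; apply: derivable_within_continuous => t /ab th.
  by have [] := du t th.
have [h1|h1|hE] := ltgtP h 0; last by rewrite hE eqxx in h0.
- have hI t : t \in `[h, 0]%R -> `|t| <= `|h|.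
    by rewrite in_itv/= => /andP[ht t0]; rewrite (ltr0_norm h1) ler0_norm// lerN2.
  have [|c cI E] := @MVT_segment R u (fun c => 'D_v g (c *: v + x))
    h 0 (ltW h1) _ (cu _ _ hI).
    by move=> t tI; apply/du/hI; apply: subset_itv_oo_cc tI.
  apply: (conc c); first exact: hI.
  by rewrite -opprB E sub0r mulrN opprK.
- have hI t : t \in `[0, h]%R -> `|t| <= `|h|.
    by rewrite in_itv/= => /andP[t0 th]; rewrite (gtr0_norm h1) ger0_norm.
  have [|c cI E] := @MVT_segment R u (fun c => 'D_v g (c *: v + x))
    0 h (ltW h1) _ (cu _ _ hI).
    by move=> t tI; apply/du/hI; apply: subset_itv_oo_cc tI.
  by apply: (conc c); [exact: hI | rewrite E subr0].
Qed.

Lemma iter_derivable_rcons (A : set V) vs v (g : V -> R) :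
  iter_derivable A (rcons vs v) g ->
  (forall x, A° x -> derivable g x v) /\ iter_derivable A vs ('D_v g).
Proof.
elim: vs => [|w vs IH] /= [H1 H2]; first by split.
have [dg Dg] := IH H1; split=> //; split=> // x /H2.
by rewrite /iter_derive foldr_rcons.
Qed.

(** The last direction is differentiated first, hence the induction from the right. The last
    quotient is commuted to the outside and replaced by a derivative at some [y]; that derivative
    moves inside [diffq p], and the induction hypothesis applies to ['D_v g] at [y]. *)
Lemma diffq_mvt (A : set V) p (g : V -> R) x :
  all (fun a => a.1 != 0) p -> iter_derivable A (unzip2 p) g ->
  (forall y, `|y - x| <= reach p -> A° y) ->
  exists2 y, `|y - x| <= reach p & diffq p g x = iter_derive (unzip2 p) g y.
Proof.
elim/last_ind: p g x => [|p [h v] IH] g x.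
  by move=> _ _ _; exists x; rewrite ?subrr ?normr0 ?reach_ge0.
rewrite all_rcons /unzip2 map_rcons => /andP[/= h0 p0].
move=> /iter_derivable_rcons[dg Dg].
have -> : reach (rcons p (h, v)) = `|h *: v| + reach p.
  by rewrite -(reach_cons (h, v)); apply: reach_perm; rewrite perm_rcons.
move=> xA.
have rch y z : `|y - x| <= `|h *: v| -> `|z - y| <= reach p ->
    `|z - x| <= `|h *: v| + reach p.
  by move=> yx zy; rewrite -[z](subrK y) -addrA addrC (le_trans (ler_normD _ _))// lerD.
have Dp y : `|y - x| <= `|h *: v| -> is_derive y v (diffq p g) (diffq p ('D_v g) y).
  by move=> yx; apply: is_derive_diffq => z zy; apply/dg/xA/(rch y).
have [y yx E] := @diffq1_mvt h v x (diffq p g) h0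
  (fun y yx => @ex_derive _ _ _ _ _ _ _ (Dp y yx)).
have [z zy Ez] := IH ('D_v g) y p0 Dg (fun z zy => xA z (rch y z yx zy)).
exists z; first exact: (rch y).
rewrite -cats1 diffq_cat diffqC /= E (@derive_val _ _ _ _ _ _ _ (Dp y yx)) Ez.
by rewrite /iter_derive foldr_rcons.
Qed.

End DifferenceQuotients.

(** * Joint limits of difference quotients *)

Section StepFilter.
Context {R : realType} {V : normedModType R}.
Implicit Types (ds l : seq V) (x v : V).

(* The steps tend to 0 independently of one another, so that the limit of a
   difference quotient along this filter is a joint limit; it can then be
   computed by letting some of the steps tend to 0 before the others. *)
Definition steps ds : set_system (seq (R * V)) :=
  filter_from [set e : R | 0 < e] (fun e =>
    [set p | [/\ perm_eq (unzip2 p) ds, all (fun a => a.1 != 0) p & reach p < e]]).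

#[global] Instance steps_proper ds : ProperFilter (steps ds).
Proof.
apply: filter_from_proper; first apply: filter_from_filter.
- by exists 1 => /=.
- move=> e e' e0 e'0; exists (Num.min e e'); first by rewrite /= lt_min e0.
  by move=> p [pds p0]; rewrite lt_min => /andP[pe pe'].
(* The filter is proper because all steps can be equal to [t = e / (S + 1)], with reach [t * S < e];
   the added 1 covers the case where all directions vanish. *)
- move=> e /= e0; pose S := \sum_(v <- ds) `|v|.
  have S0 : 0 < S + 1 by rewrite ltr_wpDl// sumr_ge0.
  pose t := e / (S + 1); have t0 : 0 < t by rewrite divr_gt0.
  exists [seq (t, v) | v <- ds]; split.
  + by rewrite /unzip2 -map_comp map_id.
  + by apply/allP => _ /mapP[v _ ->] /=; rewrite gt_eqF.
  + rewrite /reach big_map /= (eq_bigr (fun v => t * `|v|)).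
      by rewrite -mulr_sumr -/S /t mulrAC ltr_pdivrMr// ltr_pM2l// ltrDl.
    by move=> v _; rewrite normrZ gtr0_norm.
Qed.

Lemma steps_perm ds ds' : perm_eq ds ds' -> steps ds = steps ds'.
Proof.
move=> /permPr E; congr filter_from.
by apply/funext => e; apply/funext => p /=; rewrite E.
Qed.

(** An interchange of limits: with [h] fixed, sending the steps along [l] to 0 turns the joint
    quotient into the quotient of [G] with step [h], which must then be close to the joint limit
    [G']. *)
Lemma is_derive_steps {W : normedModType R} (g G : V -> W) (G' : W) v l x :
  (\forall y \near x, diffq p g y @[p --> steps l] --> G y) ->
  diffq p g x @[p --> steps (v :: l)] --> G' ->
  is_derive x v G G'.
Proof.
move=> gG gG'.
suff cG : h^-1 *: ((G \o shift x) (h *: v) - G x) @[h --> 0^'] --> G'.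
  by apply: DeriveDef; [apply/cvg_ex; exists G' | apply: cvg_lim].
apply/cvgrPdist_lt => e e0.
have e2 : 0 < e / 2 by rewrite divr_gt0.
(* Reach below [r] puts the joint quotient within [e / 2] of [G']; half of [r] is allotted to
   [h *: v], half to the remaining steps. *)
have [r /= r0 Hr] := (@cvgrPdist_lt _ _ _ _ _ _ _).1 gG' _ e2.
have r2 : 0 < r / 2 by rewrite divr_gt0.
have hv0 : h *: v @[h --> (0 : R)^'] --> (0 : V).
  rewrite -[X in _ --> X](scale0r v); apply: cvgZr_tmp.
  exact: cvg_within.
have hvx : h *: v + x @[h --> (0 : R)^'] --> x.
  by rewrite -[X in _ --> X]add0r; apply: cvgD => //; exact: cvg_cst.
have gx := nbhs_singleton gG.
near=> h.
have h0 : h != 0 by near: h; exact: nbhs_dnbhs_neq.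
have gh : diffq p g (h *: v + x) @[p --> steps l] --> G (h *: v + x).
  by near: h; exact: (hvx _ gG).
have hv : `|h *: v| < r / 2.
  by near: h; exact: (cvgr0_norm_lt _ hv0).
have gq : diffq ((h, v) :: p) g x @[p --> steps l] -->
    h^-1 *: (G (h *: v + x) - G x).
  by apply: cvgZl_tmp; exact: cvgB.
(* The list [p] is chosen after [h], small enough that the quotient along [(h, v) :: p] is within
   [e / 2] of its limit for this [h]. *)
near (steps l) => p.
rewrite /= (le_lt_trans (ler_distD (diffq ((h, v) :: p) g x) _ _))//.
rewrite [ltRHS]splitr ltrD//.
  apply: Hr => /=.
  have [pl p0 pr] :
      [/\ perm_eq (unzip2 p) l, all (fun a => a.1 != 0) p & reach p < r / 2].
    by near: p; exists (r / 2).
  by rewrite perm_cons h0; split=> //; rewrite reach_cons [ltRHS]splitr ltrD.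
by rewrite distrC; near: p; exact: ((@cvgrPdist_lt _ _ _ _ _ _ _).1 gq _ e2).
Unshelve. all: by end_near. Qed.

End StepFilter.

(** * Derivatives of a feature map obtained from those of its kernel *)

Section FeatureMap.
Context {R : realType} {V : normedModType R} {H : completeNormedModType R}.
Variables (dot : {dot H for idfun}) (X : set V) (phi : V -> H).
Hypothesis dotE : forall u : H, `|u| ^+ 2 = dot u u.
Hypothesis XclX : X `<=` closure X°.
Implicit Types (l ds : seq V) (x y v : V).

Let kernel (z : V * V) : R := dot (phi z.1) (phi z.2).

Let dirs2 ds : seq (V * V) := [seq (v, 0) | v <- ds] ++ [seq (0, v) | v <- ds].

Definition steps2 (p p' : seq (R * V)) : seq (R * (V * V)) :=
  [seq (a.1, (a.2, 0)) | a <- p] ++ [seq (a.1, (0, a.2)) | a <- p'].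

(** By bilinearity, steps in the first argument act on one factor and steps in the second argument
    on the other. *)
Lemma diffq_kernel p p' (z : V * V) :
  diffq (steps2 p p') kernel z = dot (diffq p phi z.1) (diffq p' phi z.2).
Proof.
rewrite /steps2 diffq_cat.
have -> : diffq [seq (a.1, (0, a.2) : V * V) | a <- p'] kernel =
          (fun z : V * V => dot (phi z.1) (diffq p' phi z.2)).
  elim: p' => [//|a p' IH] /=; rewrite IH; apply/funext => -[x y] /=.
  by rewrite scaler0 add0r -linearBr/= -linearZr_LR.
elim: p z => [//|a p IH] [x y] /=.
by rewrite !IH /= scaler0 add0r -linearBl/= -linearZl_LR.
Qed.

(** The product carries the maximum norm, so a direction with one zero component keeps its norm. *)
Lemma reach_steps2 p p' : reach (steps2 p p') = reach p + reach p'.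
Proof.
rewrite /reach big_cat !big_map /=; congr (_ + _); apply: eq_bigr => a _.
  by rewrite prod_normE /= scaler0 normr0 max_l.
by rewrite prod_normE /= scaler0 normr0 max_r.
Qed.

Lemma unzip2_steps2 p p' ds : unzip2 p = ds -> unzip2 p' = ds ->
  unzip2 (steps2 p p') = dirs2 ds.
Proof.
by move=> pds p'ds; rewrite /dirs2 -{1}pds -p'ds /unzip2 map_cat -!map_comp.
Qed.

Lemma interior_setX x y : X° x -> X° y -> (X `*` X)° (x, y).
Proof. by move=> Xx Xy; exists (X, X). Qed.

(** Turns limits within the square of [X] into limits along product filters, the form used by the
    Gram lemmas. *)
Lemma within_setX_sub (A : set V) x y : A `<=` X ->
  within (X `*` X) (nbhs (x, y)) `<=` filter_prod (within A (nbhs x)) (within A (nbhs y)).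
Proof.
move=> AX S [[P Q] [/= Px Qy] PQ]; exists (P `&` A, Q `&` A) => /=.
  by split; rewrite /within /=; [apply: filterS Px|apply: filterS Qy].
by move=> [x' y'] [/= [Px' /AX Xx'] [Qy' /AX Xy']]; apply: PQ.
Qed.

(** By [gram_cvg_to] it is enough to approach [(z, z)] along the points [(y, y)] and along the
    points [(y, z)]. *)
Lemma gram_within_cvg (A : set V) (k : V * V -> R) (psi : V -> H) z :
  A `<=` X -> A z -> (forall x y, A x -> A y -> dot (psi x) (psi y) = k (x, y)) ->
  k p @[p --> within (X `*` X) (nbhs (z, z))] --> k (z, z) ->
  psi y @[y --> within A (nbhs z)] --> psi z.
Proof.
move=> AX Az psik kz.
have along (g : V -> V) : g y @[y --> within A (nbhs z)] --> within A (nbhs z) ->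
    (forall y, A y -> A (g y)) ->
    dot (psi y) (psi (g y)) @[y --> within A (nbhs z)] --> dot (psi z) (psi z).
  move=> gz gA; rewrite psik//.
  have gk : k (y, g y) @[y --> within A (nbhs z)] --> k (z, z).
    apply: (cvg_comp _ _ _ kz); apply: cvg_trans (within_setX_sub AX).
    exact: (cvg_pair cvg_id gz).
  apply: cvg_trans gk; apply: near_eq_cvg.
  have : \forall y \near within A (nbhs z), A y by exact: withinT.
  by apply: filterS => y Ay /=; rewrite psik//; exact: gA.
apply: (gram_cvg_to dotE); first exact: along.
apply: (along (fun=> z)) => // S /= /nbhs_singleton/(_ Az) Sz; exact: nearW.
Qed.

(** * Limits of the difference quotients for one list of directions *)

Section OneDerivative.
Variable ds : seq V.
Hypothesis kernel_ds : cont_derivative (X `*` X) (dirs2 ds) kernel.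

Let k := derive_on (X `*` X) (dirs2 ds) kernel.

Let k_cvg x y : X x -> X y ->
  k z @[z --> within (X `*` X) (nbhs (x, y))] --> k (x, y).
Proof. by have [_ /subspace_continuousP kc] := kernel_ds => Xx Xy; exact: kc. Qed.

Lemma dot_diffq_cvg x y : X° x -> X° y ->
  dot (diffq p.1 phi x) (diffq p.2 phi y) @[p --> (steps ds, steps ds)] --> k (x, y).
Proof.
move=> Xx Xy; apply/cvgrPdist_lt => e e0.
have xy := interior_setX Xx Xy.
(* Continuity of [k] is known within the square of [X] only; around an interior point this is no
   restriction. *)
have near_xy : \forall z \near (x, y), (X `*` X)° z /\ `|k (x, y) - k z| < e.
  have : \forall z \near (x, y), (X `*` X)° z by exact: nbhs_interior.
  move/filterS2; apply; last first.
    have kxy := k_cvg (interior_subset Xx) (interior_subset Xy).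
    exact: ((@cvgrPdist_lt _ _ _ _ _ _ _).1 kxy _ e0).
  by move=> z zX H'; split=> //; apply: H'; exact: interior_subset zX.
have [r /= r0 Hr] := (@nbhs_normP _ _ _ _).1 near_xy.
have r2 : 0 < r / 2 by rewrite divr_gt0.
pose S := [set p : seq (R * V) |
  [/\ perm_eq (unzip2 p) ds, all (fun a => a.1 != 0) p & reach p < r / 2]].
exists (S, S).
  by split; exists (r / 2).
move=> [p p'] [/= [pds p0 pr] [pds' p0' pr']].
have [q pq qds] := perm_unzip2 pds; have [q' pq' qds'] := perm_unzip2 pds'.
rewrite (diffq_perm _ pq) (diffq_perm _ pq') -(diffq_kernel q q' (x, y)).
have rr : reach (steps2 q q') < r.
  by rewrite reach_steps2 -(reach_perm pq) -(reach_perm pq') [ltRHS]splitr ltrD.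
have near_r (z : V * V) : `|z - (x, y)| <= reach (steps2 q q') ->
    (X `*` X)° z /\ `|k (x, y) - k z| < e.
  by move=> zr; apply: Hr => /=; rewrite distrC (le_lt_trans zr).
have [||z /near_r zxy ->] := @diffq_mvt _ _ (X `*` X) (steps2 q q') kernel (x, y) _ _
    (fun z zr => (near_r z zr).1).
- rewrite /steps2 all_cat !all_map /preim /=.
  by rewrite -(perm_all _ pq) -(perm_all _ pq') p0 p0'.
- by rewrite (unzip2_steps2 qds qds'); case: kernel_ds.
rewrite (unzip2_steps2 qds qds'); case: zxy => zX.
(* The intermediate point is interior, so [derive_on] is the plain iterated derivative there; the
   empty list has its own branch in the definition. *)
rewrite {2}/k /derive_on; case: (dirs2 ds) => [//|v vs].
by rewrite mem_set.
Qed.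

Let J x : H := lim (diffq p phi x @[p --> steps ds]).

Let J_cvg x : X° x -> diffq p phi x @[p --> steps ds] --> J x.
Proof. by move=> Xx; exact: (gram_cvg dotE (dot_diffq_cvg Xx Xx)). Qed.

Let dot_J x y : X° x -> X° y -> dot (J x) (J y) = k (x, y).
Proof.
move=> Xx Xy; apply/esym/(cvg_unique _ (dot_diffq_cvg Xx Xy)) => //.
apply: (cvg_dot dotE).
  exact: (cvg_comp _ _ cvg_fst (J_cvg Xx)).
exact: (cvg_comp _ _ cvg_snd (J_cvg Xy)).
Qed.

(** [E] extends [J] from the interior to [X] by limits, in the same way as [derive_on]. The limits
    exist at the boundary because the Gram values of [J] are those of [k], which is continuous at
    [(z, z)]. *)
Lemma steps_limit_exists : exists J E : V -> H,
  (forall x, X° x -> diffq p phi x @[p --> steps ds] --> J x) /\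
  (forall z, X z -> J y @[y --> within X° (nbhs z)] --> E z) /\
  (forall z, X° z -> E z = J z).
Proof.
exists J, (fun z => if z \in (X° : set V) then J z
  else lim (J y @[y --> within X° (nbhs z)])).
split=> //; split; last by move=> z Xz; rewrite mem_set.
move=> z Xz.
have zX : ProperFilter (within X° (nbhs z)) by apply: within_nbhs_proper; exact: XclX.
have kz : k p @[p --> (within X° (nbhs z), within X° (nbhs z))] --> k (z, z).
  apply: cvg_trans (k_cvg Xz Xz); apply: cvg_app.
  by apply: within_setX_sub; exact: interior_subset.
(* At an interior point the limit has to be [J z]; elsewhere [E z] is the limit by definition and
   only its existence is at stake. *)
have [/[!inE] zXi|zXi] := boolP (z \in (X° : set V)).
  by apply: (gram_within_cvg _ zXi dot_J (k_cvg Xz Xz)); exact: interior_subset.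
have dotJ : dot (J p.1) (J p.2)
    @[p --> (within X° (nbhs z), within X° (nbhs z))] --> k (z, z).
  apply: cvg_trans kz; apply: near_eq_cvg.
  exists (X°, X°) => /=; first by split; exact: withinT.
  by move=> [x y] [/= Xx Xy]; rewrite dot_J.
exact: (gram_cvg dotE dotJ).
Qed.

End OneDerivative.

(** Extension by continuity: [E t] is compared with [E z] through a value [u y] at an interior point
    [y] near both. Taking the interior of the set of good points makes it a neighbourhood of each
    [t] in it. *)
Lemma within_continuous_limit (u E : V -> R) :
  (forall z, X z -> u y @[y --> within X° (nbhs z)] --> E z) ->
  {within X, continuous E}.
Proof.
move=> uE; apply/subspace_continuousP => z Xz; apply/cvgrPdist_le => e e0.
have e2 : 0 < e / 2 by rewrite divr_gt0.
have uz : nbhs z [set y | X° y -> `|E z - u y| < e / 2]°.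
  by apply: nbhs_interior; exact: ((@cvgrPdist_lt _ _ _ _ _ _ _).1 (uE z Xz) _ e2).
rewrite near_withinE; near_simpl.
apply: filterS uz => t ut Xt.
have tX : ProperFilter (within X° (nbhs t)) by apply: within_nbhs_proper; exact: XclX.
have ut' := (@cvgrPdist_lt _ _ _ _ _ _ _).1 (uE t Xt) _ e2.
have [y [/= zy ty]] := filter_ex (filterI (ut : within X° (nbhs t) _) (ut' _)).
rewrite (le_trans (ler_distD (u y) _ _))// [leRHS]splitr lerD ?ltW// distrC.
exact: ty.
Qed.

(** One order of the directions is enough, since [steps] is invariant under permutation. *)
Definition smooth_kernel l :=
  exists2 ds, perm_eq l ds & cont_derivative (X `*` X) (dirs2 ds) kernel.

Lemma is_derive_dot (G : V -> H) (G' : H) x v f :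
  is_derive x v G G' -> is_derive x v (fun y => dot f (G y)) (dot f G').
Proof.
move=> [dG <-].
suff cG : h^-1 *: (((fun y => dot f (G y)) \o shift x) (h *: v) - dot f (G x))
    @[h --> 0^'] --> dot f ('D_v G x).
  by apply: DeriveDef; [apply/cvg_ex; eexists; exact: cG | apply: cvg_lim].
under eq_fun do rewrite /= -linearBr/= -linearZr_LR/=.
by apply: (cvg_dot dotE); [exact: cvg_cst | exact: dG].
Qed.

(** By induction on [l], the joint limit for the tail is the derivative along the tail, and
    [is_derive_steps] shows that its derivative along [v] is the joint limit for [v :: l]. Every
    suffix needs its own joint limit, hence the hypothesis on all [drop n l]. *)
Lemma iter_derive_interior l J : (forall n, smooth_kernel (drop n l)) ->
  (forall x, X° x -> diffq p phi x @[p --> steps l] --> J x) ->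
  forall f, iter_derivable X l (fun x => dot f (phi x)) /\
    (forall x, X° x -> iter_derive l (fun x => dot f (phi x)) x = dot f (J x)).
Proof.
elim: l J => [|v l IH] J gl lJ f.
  split=> // x Xx /=; congr (dot f _).
  apply: (cvg_unique _ _ (lJ x Xx)) => //.
  (* Any positive bound serves: without directions the list of steps is empty. *)
  apply: cvg_near_cst; exists 1 => //= p [/perm_size].
  by rewrite size_map => /size0nil ->.
have [J' lJ'] : exists J' : V -> H,
    forall x, X° x -> diffq p phi x @[p --> steps l] --> J' x.
  have [ds lds kds] := gl 1; rewrite /= drop0 in lds.
  have [J' [_ [J'P _]]] := steps_limit_exists kds.
  by exists J'; rewrite (steps_perm lds).
have [dl El] := IH J' (fun n => gl n.+1) lJ' f.
have dvl x : X° x ->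
    is_derive x v (iter_derive l (fun x => dot f (phi x))) (dot f (J x)).
  move=> Xx; have nX : nbhs x X° by apply: nbhs_interior.
  apply: (near_eq_is_derive (f := fun y => dot f (J' y))).
    by apply: filterS nX => y /El ->.
  apply: is_derive_dot; apply: (is_derive_steps _ (lJ x Xx)).
  by apply: filterS nX => y /lJ'.
split; first by split=> // x /dvl [].
by move=> x /dvl [].
Qed.

(** [Psi] is chosen before [f], so that [Psi x] represents the derivative at [x] as a functional of
    [f]. *)
Lemma kernel_cont_derivative l : (forall n, smooth_kernel (drop n l)) ->
  exists Psi : V -> H, forall f : H,
    cont_derivative X l (fun x => dot f (phi x)) /\
    (forall x, X x -> derive_on X l (fun x => dot f (phi x)) x = dot f (Psi x)).
Proof.
move=> gl; have [ds lds kds] := gl 0; rewrite drop0 in lds.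
(* Order 0 is separate: there [derive_on] is the function itself even at the boundary, so [Psi] must
   be [phi] and not a limit from the interior. *)
case: l gl lds => [|v l] gl lds.
  exists phi => f; split=> //; split=> //; apply/subspace_continuousP => z Xz.
  apply: (cvg_dot dotE); first exact: cvg_cst.
  move: kds; rewrite (size0nil (esym (perm_size lds))) => -[_ /subspace_continuousP].
  by move=> /(_ (z, z) (conj Xz Xz)); exact: gram_within_cvg.
have [J [E [lJ [JE EJ]]]] := steps_limit_exists kds; rewrite -(steps_perm lds) in lJ.
exists E => f; have [dl El] := iter_derive_interior gl lJ f.
have JEf z : X z -> dot f (J y) @[y --> within X° (nbhs z)] --> dot f (E z).
  by move=> Xz; apply: (cvg_dot dotE); [exact: cvg_cst | exact: JE].
have dE z : X z -> derive_on X (v :: l) (fun x => dot f (phi x)) z = dot f (E z).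
  move=> Xz; rewrite /derive_on; have [/[!inE] zX|_] := boolP (z \in (X° : set V)).
    by rewrite El// EJ.
  have zX : ProperFilter (within X° (nbhs z)) by apply: within_nbhs_proper; exact: XclX.
  apply: cvg_lim => //; apply: cvg_trans (JEf z Xz); apply: near_eq_cvg.
  have : \forall y \near within X° (nbhs z), X° y by exact: withinT.
  by apply: filterS => y /El ->.
split=> //; split=> //.
apply: (within_continuous_limit (u := fun y => dot f (J y))) => z Xz.
by rewrite dE//; exact: JEf.
Qed.
End FeatureMap.

(** * Matrix entries and multi-indices *)

Lemma mulmx_delta_col (R : pzSemiRingType) (m n : nat) (A : 'M[R]_(m, n)) i j :
  (A *m delta_mx j 0 : 'cV_m) i 0 = A i j.
Proof. by rewrite -colE mxE. Qed.

Lemma count_mi_seq (d : nat) (r : 'I_d -> nat) i : count_mem i (mi_seq r) = r i.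
Proof.
rewrite /mi_seq count_flatten -map_comp sumnE big_map big_enum /= (bigD1 i)//=.
rewrite count_nseq /= eqxx mul1n big1 ?addn0// => j ji.
by rewrite count_nseq /= (negbTE ji).
Qed.

Lemma size_mi_seq (d : nat) (r : 'I_d -> nat) : size (mi_seq r) = mi_order r.
Proof.
rewrite /mi_seq size_flatten /shape -map_comp sumnE big_map big_enum /=.
by apply: eq_bigr => i _; rewrite size_nseq.
Qed.

Lemma perm_mi_seq (d : nat) (l : seq 'I_d) : perm_eq l (mi_seq (fun i => count_mem i l)).
Proof. by apply/allP => i _ /=; rewrite count_mi_seq. Qed.

(** * Derivatives of functions of the RKHS as inner products *)

Section Rkhs.
Context {R : realType} {d Q s : nat} {X : set 'rV[R]_d}.
Variables (K : X -> X -> 'M[R]_Q) (F : rkhs K).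
Hypothesis XclX : X `<=` closure X°.
Hypothesis K_Css : Css s K.

Local Notation dot := (rkhs_dot F).
Local Notation coord f q := (fun x : X => rkhs_fun F f x q 0).

Lemma rkhs_reprE (x : X) (q : 'I_Q) : exists k : F,
  rkhs_fun F k = (fun x' => K x' x *m delta_mx q 0) /\
  (forall f, dot f k = coord f q x).
Proof.
have [k [kE kf]] := rkhs_repr F x (delta_mx q 0); exists k; split=> // f.
rewrite kf mxE (bigD1 q)//= !mxE !eqxx mulr1 big1 ?addr0// => i iq.
by rewrite !mxE (negbTE iq) mulr0.
Qed.

Lemma coord_cont_derivative (q : 'I_Q) (l : seq 'I_d) : (size l <= s)%N ->
  exists Psi : X -> F, forall f : F,
    cont_derivative X [seq basis_vec i | i <- l] (zext (coord f q)) /\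
    (forall x, derive_on X [seq basis_vec i | i <- l] (zext (coord f q)) (val x) =
       dot f (Psi x)).
Proof.
move=> ls; have [rep repP] := choice (fun x => rkhs_reprE x q).
(* Extending the representers by 0 matches [zext], so the two identities below hold on the whole
   space and not only on [X]. *)
pose phi : 'rV[R]_d -> F := 'valL_ 0 rep.
have zextE f : zext (coord f q) = (fun v => dot f (phi v)).
  apply/funext => v; rewrite /zext /phi /valL_ /=.
  by case: ('oinv_ _ v) => [x|] /=; rewrite ?linear0r// (repP x).2.
have zext2E : zext2 (fun x y => K x y q q) = (fun z => dot (phi z.1) (phi z.2)).
  apply/funext => z; rewrite /zext2 /zext /phi /valL_ /=.
  case: ('oinv_ _ z.1) => [x|] /=; last by rewrite linear0l.
  case: ('oinv_ _ z.2) => [y|] /=; last by rewrite linear0r.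
  by rewrite dotC (repP x).2 (repP y).1 mulmx_delta_col.
have gl n : smooth_kernel dot X phi (drop n [seq basis_vec i | i <- l]).
  (* Sorting the suffix by coordinate gives the fixed order in which [Css] takes its derivatives. *)
  exists (mi_dirs (fun i => count_mem i (drop n l))).
    by rewrite -map_drop /mi_dirs perm_map// perm_mi_seq.
  rewrite -zext2E; apply: K_Css; rewrite -size_mi_seq -(perm_size (perm_mi_seq _)).
  by rewrite size_drop (leq_trans (leq_subr _ _)).
have [Psi PsiP] := kernel_cont_derivative (@rkhs_norm _ _ _ _ F) XclX gl.
exists (Psi \o val) => f; rewrite zextE; split; first by case: (PsiP f).
by move=> x; case: (PsiP f) => _; apply; exact: set_valP.
Qed.

Lemma rkhs_Cs (f : F) : Cs s (rkhs_fun F f).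
Proof. by move=> q l /(coord_cont_derivative q)[Psi /(_ f)[]]. Qed.

Lemma partial_repr (q : 'I_Q) (r : 'I_d -> nat) (x : X) : (mi_order r <= s)%N ->
  exists g : F, forall f, partial r (coord f q) x = dot f g.
Proof.
rewrite -size_mi_seq => /(coord_cont_derivative q)[Psi PsiP].
by exists (Psi x) => f; case: (PsiP f) => _; apply.
Qed.

(** The representer is the same linear combination of the representers of the partial
    derivatives. *)
Lemma O_1_repr (q : 'I_Q) (D : (X -> R) -> X -> R) (x : X) : O_1 s D ->
  exists g : F, forall f, D (coord f q) x = dot f g.
Proof.
move=> [n [c [r [rs DE]]]].
have [G GP] := choice (fun j => partial_repr q x (rs j)).
exists (\sum_(j < n) c j *: G j) => f; rewrite DE linear_sumr.
by apply: eq_bigr => j _; rewrite linearZr_LR /= GP.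
Qed.

Lemma vec_op_repr (beta : 'I_Q -> R) (Dq : 'I_Q -> (X -> R) -> X -> R) (x : X) :
  (forall q, O_1 s (Dq q)) ->
  exists g : F, forall f, vec_op beta Dq (rkhs_fun F f) x = dot f g.
Proof.
move=> DqO; have [G GP] := choice (fun q => O_1_repr q x (DqO q)).
exists (\sum_q beta q *: G q) => f; rewrite /vec_op linear_sumr.
by apply: eq_bigr => q _; rewrite linearZr_LR /= GP.
Qed.

End Rkhs.

Theorem lemma1 (R : realType) (d Q s : nat) (X : set 'rV[R]_d)
    (K : X -> X -> 'M[R]_Q) (F : rkhs K)
    (beta : 'I_Q -> R) (Dq : 'I_Q -> (X -> R) -> X -> R) :
  X `<=` closure X° ->
  matrix_kernel K ->
  Css s K ->
  (forall q, O_1 s (Dq q)) ->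
  forall (f : F) (x : X),
    Cs s (rkhs_fun F f) /\
    exists g : F,
      rkhs_fun F g = (fun x' => op_kernel beta Dq K x' x) /\
      vec_op beta Dq (rkhs_fun F f) x = rkhs_dot F f g.
Proof.
move=> XclX [Ksym _] K_Css DqO f x; split; first exact: rkhs_Cs.
have [g gP] := vec_op_repr F XclX K_Css beta x DqO.
exists g; split; last exact: gP.
(* Coordinate [i] of [g] at [x'] is its inner product with the representer [k] of [f |-> f_i(x')],
   hence the operator applied to [k], the [i]-th column of [K(., x')], at [x]. Symmetry of the
   kernel turns the entries [K(y, x')_(q,i)] into [K(x', y)_(i,q)]. *)
apply/funext => x'; apply/matrixP => i j; rewrite (ord1 j).
have [k [kE kf]] := rkhs_reprE F x' i.
rewrite -kf dotC -gP /vec_op /op_kernel summxE; apply: eq_bigr => q _.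
rewrite [RHS]mxE mulmx_delta_col mxE; congr (_ * Dq q _ x).
by apply/funext => y; rewrite kE mulmx_delta_col Ksym mxE.
Qed.
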